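(* Let $n\ge 2$. If $\Gamma$ is a polygonal digraph of order $n$, then $\operatorname{sp}(\Gamma)\le n$. Moreover, this bound is sharp for every order $n\ge 4$: for every integer $n\ge 4$ there exists a polygonal digraph $\Gamma$ of order $n$ with $\operatorname{sp}(\Gamma)=n$.
   Context: A simple digraph $\Gamma=(V,E)$ of order $n$ has vertex set $V=\{1,\dots,n\}$ and edge set $E\subseteq V\times V$ with no loops and no multi-edges (both $(i,j)$ and $(j,i)$ may be edges). Its adjacency matrix is $A=[a_{ij}]$ with $a_{ij}=1$ if $(i,j)\in E$ and $a_{ij}=0$ otherwise, and its Laplacian matrix is $L=D-A$, where $D$ is the diagonal matrix whose $i$th diagonal entry is the out-degree $d^+(i)$ (the number of edges of the form $(i,j)\in E$). Let $\mathbf{e}$ be the all ones vector in $\mathbb{R}^n$. For $n\ge 2$ define \[ \alpha(\Gamma)=\min_{\mathbf{x}\in\mathbb{R}^n,\ \mathbf{x}\perp\mathbf{e},\ \|\mathbf{x}\|=1}\mathbf{x}^TL\mathbf{x},\qquad \beta(\Gamma)=\max_{\mathbf{x}\in\mathbb{R}^n,\ \mathbf{x}\perp\mathbf{e},\ \|\mathbf{x}\|=1}\mathbf{x}^TL\mathbf{x}, \] where $\|\cdot\|$ is the Euclidean norm. The Laplacian spread is $\operatorname{sp}(\Gamma)=\beta(\Gamma)-\alpha(\Gamma)$. The restricted numerical range of $\Gamma$ is $W_r(\Gamma)=W_r(L)=\{\mathbf{x}^*L\mathbf{x}:\mathbf{x}\in\mathbb{C}^n,\ \mathbf{x}\perp\mathbf{e},\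 \|\mathbf{x}\|=1\}\subset\mathbb{C}$. A restrictor matrix of order $n$ is an $n\times(n-1)$ matrix $Q$ whose columns form an orthonormal basis of $\mathbf{e}^{\perp}$. A digraph $\Gamma$ is polygonal if $W_r(\Gamma)$ is a convex polygon in the complex plane (degenerate cases, i.e. a single point or a line segment, are allowed), that is, $W_r(\Gamma)$ equals the convex hull of the eigenvalues of $Q^*LQ$ for any restrictor matrix $Q$ of order $n$. *)

(* Defs.v *)
From HB Require Import structures.
From mathcomp Require Import all_boot all_order all_algebra.
From mathcomp Require Import complex.
From mathcomp Require Import all_classical all_reals all_analysis.

Unset Printing Implicit Defensive.

Import Order.TTheory GRing.Theory Num.Theory.
Import numFieldNormedType.Exports.

Local Open Scope classical_set_scope.
Local Open Scope ring_scope.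
Local Open Scope sesquilinear_scope.

Record digraph (n : nat) := Digraph {
  edges : {set 'I_n * 'I_n};
  edges_loopless : forall i, (i, i) \notin edges
}.
Arguments edges {n}.
Arguments edges_loopless {n}.

Definition outdeg {n} (G : digraph n) (i : 'I_n) : nat :=
  #|[set j | (i, j) \in edges G]%SET|.

Definition adjacency (K : pzRingType) {n} (G : digraph n) : 'M[K]_n :=
  \matrix_(i, j) ((i, j) \in edges G)%:R.

Definition laplacian (K : pzRingType) {n} (G : digraph n) : 'M[K]_n :=
  diag_mx (\row_i (outdeg G i)%:R) - adjacency K G.

Definition ones (K : pzRingType) (n : nat) : 'cV[K]_n := const_mx 1.

(* The norm that MathComp-Analysis puts on matrices is the sup norm, so the
   Euclidean norms on R^n and C^n are spelled out. *)
Definition enormR {R : realType} {n} (x : 'cV[R]_n) : R :=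
  Num.sqrt ((x^T *m x) 0 0).

Definition enormC {R : realType} {n} (x : 'cV[R[i]]_n) : R[i] :=
  sqrtC ((x^t* *m x) 0 0).

Definition unit_perpR (R : realType) (n : nat) : set 'cV[R]_n :=
  [set x | ((ones R n)^T *m x) 0 0 = 0 /\ enormR x = 1].

Definition unit_perpC (R : realType) (n : nat) : set 'cV[R[i]]_n :=
  [set x | ((ones R[i] n)^t* *m x) 0 0 = 0 /\ enormC x = 1].

Definition rayleigh (R : realType) {n} (G : digraph n) : set R :=
  [set (x^T *m laplacian R G *m x) 0 0 | x in unit_perpR R n].

(* For n >= 2 the infimum and the supremum are attained, i.e. they are the
   minimum and the maximum: see [alpha_min] and [beta_max] below. *)
Definition alpha (R : realType) {n} (G : digraph n) : R := inf (rayleigh R G).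

Definition beta (R : realType) {n} (G : digraph n) : R := sup (rayleigh R G).

Definition spread (R : realType) {n} (G : digraph n) : R :=
  beta R G - alpha R G.

Definition restricted_range (R : realType) {n} (G : digraph n) : set R[i] :=
  [set (x^t* *m laplacian R[i] G *m x) 0 0 | x in unit_perpC R n].

Definition restrictor {R : realType} {n} (Q : 'M[R[i]]_(n, n.-1)) : Prop :=
  Q^t* *m Q = 1%:M /\
  (forall x : 'cV[R[i]]_n,
     ((ones R[i] n)^t* *m x) 0 0 = 0 <-> exists y : 'cV[R[i]]_n.-1, x = Q *m y).

Definition convex_hull {R : realType} (S : set R[i]) : set R[i] :=
  [set z | exists (m : nat) (t : 'I_m -> R) (v : 'I_m -> R[i]),
     [/\ forall k, 0 <= t k, \sum_k t k = 1, forall k, S (v k)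
       & z = \sum_k (t k)%:C%C * v k]].

Definition polygonal (R : realType) {n} (G : digraph n) : Prop :=
  forall Q : 'M[R[i]]_(n, n.-1), restrictor Q ->
    restricted_range R G =
    convex_hull [set z | eigenvalue (Q^t* *m laplacian R[i] G *m Q) z].

Lemma rayleigh_compact (R : realType) n (G : digraph n) :
  compact (rayleigh R G).
Proof.
pose A := [set y : 'rV[R]_n | \sum_j y 0 j = 0] `&`
          [set y : 'rV[R]_n | \sum_j y 0 j * y 0 j = 1].
pose f (y : 'rV[R]_n) : R :=
  \sum_j (\sum_i y 0 i * laplacian R G i j) * y 0 j.
have normE (x : 'cV[R]_n) : (x^T *m x) 0 0 = \sum_j x^T 0 j * x^T 0 j.
  by rewrite mxE; apply: eq_bigr => j _; rewrite !mxE.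
have fE (x : 'cV[R]_n) : (x^T *m laplacian R G *m x) 0 0 = f x^T.
  by rewrite mxE; apply: eq_bigr => j _; rewrite mxE [x^T 0 j]mxE.
have perpE (x : 'cV[R]_n) : ((ones R n)^T *m x) 0 0 = \sum_j x^T 0 j.
  by rewrite mxE; apply: eq_bigr => j _; rewrite !mxE mul1r.
have -> : rayleigh R G = f @` A.
  apply/seteqP; split => [_ [x [xe x1] <-]|_ [y [ye y1] <-]].
    exists x^T; last by rewrite fE.
    split; rewrite /= -?perpE -?normE //.
    rewrite -(@sqr_sqrtr _ ((x^T *m x) 0 0)); last first.
      by rewrite normE; apply: sumr_ge0 => j _; rewrite -expr2 sqr_ge0.
    by move: x1; rewrite /enormR => ->; rewrite expr1n.
  exists y^T; last by rewrite fE trmxK.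
  split; first by rewrite perpE trmxK.
  by rewrite /enormR normE trmxK y1 sqrtr1.
have cc j : continuous (fun y : 'rV[R]_n => y 0 j) by exact: coord_continuous.
have cmul (g h : 'rV[R]_n -> R) : continuous g -> continuous h ->
    continuous (fun y => g y * h y).
  by move=> cg ch y; exact: (continuousM (cg y) (ch y)).
have csum (F : 'I_n -> 'rV[R]_n -> R) : (forall j, continuous (F j)) ->
    continuous (fun y => \sum_j F j y).
  by move=> cF; apply: continuous_big => // z; exact: add_continuous.
apply: continuous_compact.
  have cL j : continuous (fun y : 'rV[R]_n => \sum_i y 0 i * laplacian R G i j).
    apply: (csum (fun i y => y 0 i * laplacian R G i j)) => i.
    by apply: cmul; [exact: cc|move=> y; exact: cst_continuous].
  apply/continuous_subspaceT.
  apply: (csum (fun j y => (\sum_i y 0 i * laplacian R G i j) * y 0 j)) => j.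
  by apply: cmul; [exact: cL|exact: cc].
apply: bounded_closed_compact.
  exists 1; split => // M M1 y [_ y1].
  rewrite /Num.norm /= mx_normrE; apply: bigmax_le => [|[i j] _ /=].
    exact: le_trans (ltW M1).
  apply: le_trans (ltW M1); rewrite ord1 -(@expr_le1 _ 2)// -normrX.
  rewrite ger0_norm ?sqr_ge0// -y1 (bigD1 j)//= expr2 lerDl.
  by apply: sumr_ge0 => k _; rewrite -expr2 sqr_ge0.
apply: closedI.
  apply: (@preimage_closed _ _ _ [set x | x = 0]) (@closed_eq R 0) => y _.
  exact: (csum (fun j y => y 0 j)).
apply: (@preimage_closed _ _ (fun y : 'rV[R]_n => \sum_j y 0 j * y 0 j)
  [set x | x = 1]) (@closed_eq R 1) => y _.
by apply: (csum (fun j y => y 0 j * y 0 j)) => j; apply: cmul; exact: cc.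
Qed.

Lemma rayleigh_neq0 (R : realType) (n : nat) (G : digraph n) :
  (2 <= n)%N -> rayleigh R G !=set0.
Proof.
case: n G => [|[|n]] // G _.
pose d : 'cV[R]_n.+2 := delta_mx 0 0 - delta_mx (lift 0 0) 0.
pose x := (Num.sqrt 2)^-1 *: d.
exists ((x^T *m laplacian R G *m x) 0 0), x => //; split.
  rewrite -scalemxAr mxE mxE !big_ord_recl big1 => [|i _]; rewrite !mxE/=.
    by rewrite !mul1r subr0 sub0r addr0 subrr mulr0.
  by rewrite subrr mulr0.
rewrite /enormR mxE !big_ord_recl big1 => [|i _]; rewrite !mxE/=; last first.
  by rewrite subrr !mulr0.
by rewrite subr0 sub0r addr0 !mulr1 mulrN1 mulrNN -!expr2 exprVn sqr_sqrtr//
  -[in X in Num.sqrt X](div1r 2) -splitr sqrtr1.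
Qed.

Lemma alpha_min (R : realType) (n : nat) (G : digraph n) : (2 <= n)%N ->
  rayleigh R G (alpha R G) /\ forall r, rayleigh R G r -> alpha R G <= r.
Proof.
move=> n2; have [c] := compact_EVT_min (rayleigh_neq0 R n G n2)
  (rayleigh_compact R n G) (@continuous_subspaceT _ _ _ id (fun=> cvg_id)).
rewrite inE => Sc minc.
have lbc : lbound (rayleigh R G) c by move=> r Sr; apply: minc; rewrite inE.
suff -> : alpha R G = c by [].
apply/eqP; rewrite eq_le lb_le_inf ?andbT//; last by exists c.
by apply: ge_inf => //; exists c.
Qed.

Lemma beta_max (R : realType) (n : nat) (G : digraph n) : (2 <= n)%N ->
  rayleigh R G (beta R G) /\ forall r, rayleigh R G r -> r <= beta R G.
Proof.
move=> n2; have [c] := compact_EVT_max (rayleigh_neq0 R n G n2)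
  (rayleigh_compact R n G) (@continuous_subspaceT _ _ _ id (fun=> cvg_id)).
rewrite inE => Sc maxc.
have ubc : ubound (rayleigh R G) c by move=> r Sr; apply: maxc; rewrite inE.
suff -> : beta R G = c by [].
apply/eqP; rewrite eq_le ge_sup//=; last by exists c.
by apply: ub_le_sup => //; exists c.
Qed.

(* Main.v *)
(** A left eigenvector of Q^* L Q gives a left eigenvector w of L with w e = 0,
    for the same eigenvalue z.  A Gershgorin estimate yields Re z >= 0, and the
    same estimate for the complement, whose Laplacian n I - J - L has eigenvalue
    n - z at w, yields Re z <= n.  For a polygonal digraph these bounds pass to
    W_r, which contains all the values x^T L x.

    The bound is attained by joining two vertices to each other and to all the
    other n - 2 vertices: on e^perp its Laplacian acts as n P, with P the
    coordinate projection onto the two vertices, so that W_r = [0, n]; the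
    vectors e_0 - e_1 and e_2 - e_3 are eigenvectors for n and 0. *)
Require Import Defs.
From mathcomp Require Import all_boot all_order all_algebra.
From mathcomp Require Import complex ring lra.
From mathcomp Require Import all_classical all_reals all_analysis.
Import Order.TTheory GRing.Theory Num.Theory.
Local Open Scope ring_scope.
Local Open Scope sesquilinear_scope.

Set Implicit Arguments.
Unset Strict Implicit.

(** * Restrictor matrices and the eigenvalues of the compression *)

Lemma conj_onesE (R : realType) (n : nat) : (ones R[i] n)^t* = const_mx 1.
Proof. by apply/matrixP => i j; rewrite !mxE conjC1. Qed.

Lemma perp_onesP (R : realType) (n : nat) (x : 'cV[R[i]]_n) :
  ((ones R[i] n)^t* *m x) 0 0 = 0 <-> x^t* *m ones R[i] n = 0.
Proof.
have -> : x^t* *m ones R[i] n = ((ones R[i] n)^t* *m x)^t*.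
  by rewrite trmx_mul map_mxM trmxCK.
split=> [x0|/matrixP/(_ 0 0)]; last by rewrite !mxE => /eqP; rewrite conjC_eq0 => /eqP.
by apply/matrixP => i j; rewrite !ord1 [LHS]mxE [X in X^*]mxE x0 mxE conjC0.
Qed.

(** Gram-Schmidt on a row basis of the kernel of [ones]. The theorem needs one restrictor at which
    to instantiate [polygonal]. *)
Lemma restrictor_exists (R : realType) (n : nat) : (0 < n)%N ->
  exists Q : 'M[R[i]]_(n, n.-1), restrictor Q.
Proof.
case: n => // n _; pose N := kermx (ones R[i] n.+1).
have rkN : \rank N = n.
  rewrite mxrank_ker (_ : \rank (ones R[i] n.+1) = 1%N) ?subn1//.
  apply/eqP; rewrite eqn_leq rank_leq_col lt0n mxrank_eq0.
  by apply/eqP => /matrixP/(_ 0 0)/eqP; rewrite !mxE oner_eq0.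
pose B : 'M[R[i]]_(n, n.+1) := castmx (rkN, erefl) (row_base N).
have BN : (B :=: N)%MS.
  by apply: eqmx_trans (eqmx_cast _ _) (eq_row_base N).
have Bfree : row_free B by rewrite /row_free BN rkN.
have Uu := schmidt_unitarymx B (leqnSn n).
have UN : (schmidt B :=: N)%MS := eqmx_trans (eqmx_schmidt_free Bfree) BN.
exists ((schmidt B)^t*); split; first by rewrite trmxCK; exact/unitarymxP.
move=> x; rewrite perp_onesP; split=> [/sub_kermxP|[y ->]].
  rewrite -/N -UN => /submxP[y xE]; exists (y^t*).
  by rewrite -map_mxM -trmx_mul -xE trmxCK.
apply/sub_kermxP; rewrite -/N -UN.
by rewrite trmx_mul map_mxM trmxCK submxMl.
Qed.

(** Q Q^* is the orthogonal projection onto the complement of e. *)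
Lemma restrictorK (R : realType) (n : nat) (Q : 'M[R[i]]_(n, n.-1))
  (w : 'rV[R[i]]_n) :
  restrictor Q -> w *m ones R[i] n = 0 -> w *m Q *m Q^t* = w.
Proof.
move=> [QQ /(_ (w^t*))[/[swap] _ +]].
rewrite perp_onesP trmxCK => /[apply] -[y wE].
have -> : w = y^t* *m Q^t* by rewrite -map_mxM -trmx_mul -wE trmxCK.
by rewrite -(mulmxA (y^t*)) QQ mulmx1.
Qed.

Lemma mul_restrictor_perp (R : realType) (n : nat) (Q : 'M[R[i]]_(n, n.-1))
  (v : 'rV[R[i]]_n.-1) :
  restrictor Q -> v *m Q^t* *m ones R[i] n = 0.
Proof.
move=> [_ /(_ (Q *m v^t*))[_ /(_ (ex_intro _ _ erefl))]].
by rewrite perp_onesP trmx_mul map_mxM trmxCK.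
Qed.

(** * Gershgorin bounds for eigenvalues of the Laplacian *)

Lemma outdegE (K : pzRingType) (n : nat) (G : digraph n) (i : 'I_n) :
  (outdeg G i)%:R = \sum_j adjacency K G i j.
Proof.
rewrite /outdeg -sum1_card natr_sum big_mkcond/=.
by apply: eq_bigr => j _; rewrite !mxE inE; case: ifP.
Qed.

Lemma laplacianE (K : pzRingType) (n : nat) (G : digraph n) :
  laplacian K G = diag_mx (\row_i \sum_j adjacency K G i j) - adjacency K G.
Proof. by congr (diag_mx _ - _); apply/rowP => i; rewrite !mxE outdegE. Qed.

Lemma laplacian_ones (K : pzRingType) (n : nat) (G : digraph n) :
  laplacian K G *m ones K n = 0.
Proof.
apply/matrixP => i j; rewrite laplacianE mulmxBl mul_diag_mx !mxE mulr1.
by apply/eqP; rewrite subr_eq0; apply/eqP/eq_bigr => k _; rewrite !mxE mulr1.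
Qed.

(** Left eigenvectors are used because L e = 0 makes the rows orthogonal to e stable under w -> w L,
    whereas L need not preserve the columns orthogonal to e. The eigenvectors correspond by v -> v
    Q^* and w -> w Q. *)
Lemma eigenvalue_compressionP (R : realType) (n : nat) (G : digraph n)
  (Q : 'M[R[i]]_(n, n.-1)) (z : R[i]) : restrictor Q ->
  eigenvalue (Q^t* *m laplacian R[i] G *m Q) z <->
  exists w : 'rV_n, [/\ w != 0, w *m ones R[i] n = 0
                      & w *m laplacian R[i] G = z *: w].
Proof.
move=> rQ; split=> [/eigenvalueP[v vE v0]|[w [w0 we wL]]].
  exists (v *m Q^t*); split.
  - apply: contra_neq v0 => vQ.
    by rewrite -[v]mulmx1 -rQ.1 mulmxA vQ mul0mx.
  - exact: mul_restrictor_perp.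
  - set w := v *m Q^t*.
    (* The residual u is itself orthogonal to e, so u = u Q Q^*, and u Q = 0 is the eigenvalue
       equation for v. *)
    pose u := w *m laplacian R[i] G - z *: w.
    suff : u = 0 by move/eqP; rewrite subr_eq0 => /eqP.
    rewrite -(restrictorK rQ (w := u)).
      rewrite mulmxBl -scalemxAl -mulmxA -[w *m Q]mulmxA rQ.1 mulmx1.
      by rewrite -[w *m _]mulmxA [Q^t* *m _]mulmxA vE subrr mul0mx.
    rewrite mulmxBl -mulmxA laplacian_ones mulmx0 -scalemxAl.
    by rewrite (mul_restrictor_perp v rQ) scaler0 subr0.
apply/eigenvalueP; exists (w *m Q).
  by rewrite !mulmxA (restrictorK rQ we) wL -scalemxAl.
by apply: contra_neq w0 => wQ; rewrite -(restrictorK rQ we) wQ mul0mx.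
Qed.

(* Summing |z - d_j| |w_j| <= \sum_i |w_i| A_ij over j gives
   \sum_j (|z - d_j| - d_j) |w_j| <= 0, where d_j < |z - d_j| if Re z < 0. *)
Lemma weighted_laplacian_eigenvalue_Re_ge0 (R : realType) (n : nat)
  (A : 'M[R[i]]_n) (w : 'rV_n) (z : R[i]) :
  (forall i j, 0 <= A i j) -> w != 0 ->
  w *m (diag_mx (\row_i \sum_j A i j) - A) = z *: w -> 0 <= complex.Re z.
Proof.
move=> A0 w0 wE; rewrite leNgt; apply/negP => z0.
pose d j := \sum_k A j k.
have d0 j : 0 <= d j by apply: sumr_ge0.
have dz j : d j < `|z - d j|.
  (* Since d_j is real, |z - d_j| >= |Re z - d_j| = d_j - Re z > d_j. *)
  apply: lt_le_trans (normc_ge_Re _).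
  move: (d0 j); rewrite lecE => /andP[/eqP/= dI dR].
  rewrite ltcE/= dI eqxx/= raddfB/= ler0_norm; lra.
have wjE j : (z - d j) * w 0 j = - \sum_i w 0 i * A i j.
  move/matrixP: wE => /(_ 0 j); rewrite mulmxBr mul_mx_diag !mxE => wE.
  by rewrite mulrBl -wE mulrC /d; ring.
have wj0 j : 0 <= (`|z - d j| - d j) * `|w 0 j|.
  by rewrite mulr_ge0// subr_ge0 ltW.
have : \sum_j (`|z - d j| - d j) * `|w 0 j| <= 0.
  have -> : \sum_j (`|z - d j| - d j) * `|w 0 j| =
      \sum_j `|z - d j| * `|w 0 j| - \sum_j \sum_i `|w 0 i| * A i j.
    rewrite exchange_big/= -sumrB; apply: eq_bigr => j _.
    by rewrite -mulr_sumr mulrBl [d j * _]mulrC.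
  rewrite subr_le0; apply: ler_sum => j _; rewrite -normrM wjE normrN.
  apply: le_trans (ler_norm_sum _ _ _) _; apply: ler_sum => i _.
  by rewrite normrM (ger0_norm (A0 _ _)).
(* Nonnegative terms with sum zero all vanish; as the factors |z - d_j| - d_j are positive by [dz],
   this forces w = 0. *)
move=> s0; have : \sum_j (`|z - d j| - d j) * `|w 0 j| == 0.
  by rewrite eq_le s0 sumr_ge0.
rewrite psumr_eq0// => /allP wz; move/eqP: w0; apply; apply/rowP => j.
have := wz j (mem_index_enum _); rewrite /= mulf_eq0 subr_eq0 normr_eq0 mxE.
by case/orP => /eqP // dE; move: (dz j); rewrite dE ltxx.
Qed.

Lemma laplacian_eigenvalue_bounds (R : realType) (n : nat) (G : digraph n)
  (w : 'rV[R[i]]_n) (z : R[i]) :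
  w != 0 -> w *m ones R[i] n = 0 -> w *m laplacian R[i] G = z *: w ->
  0 <= complex.Re z <= n%:R.
Proof.
move=> w0 we wL; apply/andP; split.
  apply: (weighted_laplacian_eigenvalue_Re_ge0 (A := adjacency R[i] G)) w0 _.
    by move=> i j; rewrite mxE ler0n.
  by rewrite -laplacianE.
have : 0 <= complex.Re (n%:R - z).
  (* [n I - J - L] is the Laplacian of the complement; the loops of the weights
     [J - A] cancel. *)
  apply: (weighted_laplacian_eigenvalue_Re_ge0
    (A := const_mx 1 - adjacency R[i] G)) w0 _.
    by move=> i j; rewrite !mxE subr_ge0 lern1 leq_b1.
  have -> : diag_mx (\row_i \sum_j (const_mx 1 - adjacency R[i] G) i j) -
      (const_mx 1 - adjacency R[i] G) =
      n%:R%:M - ones R[i] n *m const_mx 1 - laplacian R[i] G.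
    apply/matrixP => i j; rewrite laplacianE !mxE big_ord1 !mxE mulr1.
    under eq_bigr do rewrite !mxE.
    rewrite sumrB sumr_const card_ord.
    under [in RHS]eq_bigr do rewrite mxE.
    by case: (i == j); rewrite ?mulr1n ?mulr0n; ring.
  rewrite (mulmxBr _ _ (laplacian _ _)) mulmxBr mul_mx_scalar mulmxA we mul0mx subr0 wL.
  by rewrite scalerBl.
by rewrite raddfB/= raddfMn/= subr_ge0.
Qed.

(** * Passage from eigenvalues and complex vectors to real Rayleigh values *)

Lemma convex_hull_Re_bounds (R : realType) (S : set R[i]) (a b : R) (z : R[i]) :
  (forall v, S v -> a <= complex.Re v <= b) -> convex_hull S z ->
  a <= complex.Re z <= b.
Proof.
move=> Sab [m [t [v [t0 t1 Sv ->]]]].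
have -> : complex.Re (\sum_k (t k)%:C%C * v k) = \sum_k t k * complex.Re (v k).
  by rewrite raddf_sum; apply: eq_bigr => k _/=; case: (v k) => x y /=; ring.
rewrite -[a]mul1r -[b]mul1r -t1 !mulr_suml.
by apply/andP; split; apply: ler_sum => k _; apply: ler_wpM2l => //;
  case/andP: (Sab _ (Sv k)).
Qed.

Lemma rayleigh_restricted_range (R : realType) (n : nat) (G : digraph n) (r : R) :
  rayleigh R G r -> restricted_range R G r%:C%C.
Proof.
pose f : R -> R[i] := real_complex R.
have fC m k (M : 'M[R]_(m, k)) : (map_mx f M)^t* = map_mx f M^T.
  apply/matrixP => i j; rewrite !mxE; apply: conj_Creal.
  by rewrite complex_real.
move=> [x [xe x1] <-]; exists (map_mx f x); last first.
  have -> : laplacian R[i] G = map_mx f (laplacian R G).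
    apply/matrixP => i j; rewrite !mxE /f rmorphB/= rmorphMn/=.
    by rewrite !rmorph_nat.
  by rewrite fC -!map_mxM mxE.
split.
  have -> : ones R[i] n = map_mx f (ones R n).
    by apply/matrixP => i j; rewrite !mxE /f rmorph1.
  by rewrite fC -map_mxM mxE xe /f rmorph0.
rewrite /enormC fC -map_mxM mxE.
have xx0 : 0 <= (x^T *m x) 0 0.
  by rewrite mxE; apply: sumr_ge0 => j _; rewrite mxE -expr2 sqr_ge0.
have -> : (x^T *m x) 0 0 = 1.
  by rewrite -(sqr_sqrtr xx0) -/(enormR x) x1 expr1n.
by rewrite /f rmorph1 sqrtC1.
Qed.

(** * The extremal digraph *)

Section DominatingPair.
Variable n : nat.

Definition dominating_pair_edges : {set 'I_n * 'I_n} :=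
  [set p : 'I_n * 'I_n | (p.1 < 2)%N && (p.1 != p.2)]%SET.

Lemma dominating_pair_loopless (i : 'I_n) : (i, i) \notin dominating_pair_edges.
Proof. by rewrite inE eqxx andbF. Qed.

Definition dominating_pair : digraph n := Digraph n _ dominating_pair_loopless.

(** For i < 2 the out-degree n - 1 on the diagonal is split as n plus the -1 that fills the rest of
    the row; this constant row annihilates vectors of zero sum. *)
Lemma laplacian_dominating_pairE (K : pzRingType) (i j : 'I_n) :
  laplacian K dominating_pair i j = (i < 2)%:R * (n%:R * (i == j)%:R - 1).
Proof.
have aE k l : adjacency K dominating_pair k l =
    (k < 2)%:R * (1 - (k == l)%:R).
  by rewrite !mxE inE; case: ltnP; case: eqP => _ _;
    rewrite ?(subrr, subr0, mulr1, mulr0, mul0r).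
rewrite laplacianE !mxE.
under eq_bigr do rewrite -/(adjacency _ _) aE.
rewrite -mulr_sumr sumrB sumr_const card_ord (bigD1 i)//= eqxx big1 => [|k /negPf].
  move: (aE i j); rewrite mxE => ->; rewrite addr0.
  case: eqP => _; rewrite !(mulr1n, mulr0n, mulr1, mulr0, subr0, subrr, sub0r)//.
  by rewrite mulrN mulr1.
by rewrite eq_sym => ->.
Qed.

(** The row y is independent of x, so that the formula covers x^T L x, x^* L x and w L w^* alike. *)
Lemma dominating_pair_form (K : comPzRingType) (y : 'rV[K]_n) (x : 'cV[K]_n) :
  \sum_i x i 0 = 0 ->
  (y *m laplacian K dominating_pair *m x) 0 0 =
    n%:R * \sum_(i < n | (i < 2)%N) y 0 i * x i 0.
Proof.
move=> x0; rewrite -mulmxA mxE mulr_sumr [RHS]big_mkcond/=; apply: eq_bigr => i _.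
rewrite mxE; under eq_bigr do rewrite laplacian_dominating_pairE -mulrA mulrBl mul1r.
rewrite -mulr_sumr sumrB x0 subr0 (bigD1 i)//= eqxx big1 => [|k /negPf].
  by case: ltnP => _; rewrite ?mul0r ?mulr0// mul1r addr0 mulr1 mulrCA.
by rewrite eq_sym => ->; rewrite mulr0 mul0r.
Qed.

(** The first hypothesis cancels the contribution of the constant -1 rows; what remains of L is
    diagonal, with entries n and 0. *)
Lemma dominating_pair_eigenvector (K : comPzRingType) (w : 'rV[K]_n) (z : K) :
  \sum_(i < n | (i < 2)%N) w 0 i = 0 ->
  (forall i : 'I_n, n%:R * (i < 2)%:R * w 0 i = z * w 0 i) ->
  w *m laplacian K dominating_pair = z *: w.
Proof.
move=> w0 wz; apply/rowP => j; rewrite !mxE -wz.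
under eq_bigr do rewrite laplacian_dominating_pairE mulrA mulrBr mulr1.
rewrite sumrB [X in _ - X](_ : _ = 0) ?subr0; last first.
  rewrite -[RHS]w0 [RHS]big_mkcond/=; apply: eq_bigr => i _.
  by case: ltnP; rewrite ?mulr1 ?mulr0.
rewrite (bigD1 j)//= eqxx big1 => [|k /negPf ->]; last by rewrite !mulr0.
by rewrite addr0 mulr1 mulrC [w 0 j * _]mulrC mulrA.
Qed.

(** The value is n times the part of the squared norm carried by the first two coordinates. The
    order on [R[i]] makes the conclusion also say that z is real. *)
Lemma dominating_pair_range (R : realType) (z : R[i]) :
  restricted_range R dominating_pair z -> 0 <= z <= n%:R.
Proof.
move=> [x [xe x1] <-].
have {}xe : \sum_i x i 0 = 0.
  by rewrite -[RHS]xe mxE; apply: eq_bigr => i _; rewrite conj_onesE mxE mul1r.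
have {}x1 : \sum_i `|x i 0| ^+ 2 = 1.
  rewrite -[RHS](expr1n _ 2) -x1 sqrtCK mxE; apply: eq_bigr => i _.
  by rewrite !mxE normCKC.
rewrite dominating_pair_form//.
under eq_bigr do rewrite !mxE -normCKC.
have sq0 i : 0 <= `|x i 0| ^+ 2 by rewrite exprn_ge0.
rewrite mulr_ge0 ?ler0n ?sumr_ge0//=.
rewrite ler_piMr ?ler0n// -x1 [leRHS](bigID (fun i : 'I_n => (i < 2)%N))/=.
by rewrite lerDl sumr_ge0.
Qed.

(** Pairing w L = z w with w^* gives z |w|^2 >= 0, hence z is real and nonnegative; the general
    bound Re z <= n then bounds z itself. *)
Lemma dominating_pair_eigenvalue_bounds (R : realType) (w : 'rV[R[i]]_n)
  (z : R[i]) :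
  w != 0 -> w *m ones R[i] n = 0 ->
  w *m laplacian R[i] dominating_pair = z *: w -> 0 <= z <= n%:R.
Proof.
move=> w0 we wL.
have /andP[zR0 zRn] := laplacian_eigenvalue_bounds w0 we wL.
have ww : 0 < \sum_i `|w 0 i| ^+ 2.
  rewrite lt0r sumr_ge0 ?andbT; last by move=> *; rewrite exprn_ge0.
  rewrite psumr_eq0; last by move=> *; rewrite exprn_ge0.
  apply: contra_neqN w0 => /allP w0; apply/rowP => i.
  by have := w0 i (mem_index_enum _); rewrite sqrf_eq0 normr_eq0 mxE => /eqP.
have : 0 <= z * \sum_i `|w 0 i| ^+ 2.
  have -> : z * \sum_i `|w 0 i| ^+ 2 =
      (w *m laplacian R[i] dominating_pair *m w^t*) 0 0.
    rewrite wL -scalemxAl mxE; congr (_ * _); rewrite mxE.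
    by apply: eq_bigr => i _; rewrite !mxE normCK.
  rewrite dominating_pair_form.
    rewrite mulr_ge0 ?ler0n ?sumr_ge0// => i _.
    by rewrite !mxE -normCK exprn_ge0.
  under eq_bigr do rewrite !mxE.
  rewrite -rmorph_sum/= -[RHS](conjC0 _); congr (_^*).
  move/matrixP: we => /(_ 0 0); rewrite !mxE => we; rewrite -[RHS]we.
  by apply: eq_bigr => i _; rewrite mxE mulr1.
rewrite pmulr_lge0// => z0; rewrite z0/=.
move: z0; rewrite !lecE => /andP[/eqP/= zI _].
by rewrite zI raddfMn/= raddfMn/= mul0rn eqxx.
Qed.

End DominatingPair.

(** Each pair sums to zero, so the vector is orthogonal to e for all a and b. In the extremal
    digraph the a-pair sits on the dominating vertices (eigenvalue n) and the b-pair off them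
    (eigenvalue 0). *)
Definition two_pairs {K : zmodType} {m : nat} (a b : K) : 'cV[K]_m.+4 :=
  \col_i nth 0 [:: a; - a; b; - b] i.

Lemma sum_two_pairs (K L : zmodType) (m : nat) (f : K -> L) (a b : K) :
  f 0 = 0 ->
  \sum_i f ((two_pairs a b : 'cV_m.+4) i 0) = f a + f (- a) + (f b + f (- b)).
Proof.
move=> f0; rewrite !big_ord_recl big1 => [|i _]; rewrite !mxE//=.
  by rewrite addr0 !addrA.
by rewrite nth_nil.
Qed.

Lemma sum_pair_two_pairs (K L : zmodType) (m : nat) (f : K -> L) (a b : K) :
  \sum_(i < m.+4 | (i < 2)%N) f ((two_pairs a b : 'cV_m.+4) i 0) = f a + f (- a).
Proof.
by rewrite big_mkcond !big_ord_recl big1//= !mxE/= !addr0.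
Qed.

Lemma dominating_pair_rayleigh (R : realType) (m : nat) (p : R) : 0 <= p <= 1 ->
  rayleigh R (dominating_pair m.+4) (m.+4%:R * p).
Proof.
move=> /andP[p0 p1].
(* Chosen so that 2 a^2 = p and 2 b^2 = 1 - p: the dominating pair carries the fraction p of the
   unit norm squared. *)
pose a := Num.sqrt (p / 2); pose b := Num.sqrt ((1 - p) / 2).
have aa : a ^+ 2 = p / 2 by rewrite sqr_sqrtr// divr_ge0.
have bb : b ^+ 2 = (1 - p) / 2 by rewrite sqr_sqrtr// divr_ge0// subr_ge0.
have x0 : \sum_i (two_pairs a b : 'cV_m.+4) i 0 = 0.
  by rewrite (@sum_two_pairs _ _ _ id)// !subrr addr0.
exists (two_pairs a b).
  split.
    by rewrite -[RHS]x0 mxE; apply: eq_bigr => i _; rewrite mxE [ones _ _ _ _]mxE mul1r.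
  rewrite /enormR mxE -[RHS]sqrtr1; congr Num.sqrt.
  under eq_bigr do rewrite mxE -expr2.
  rewrite (@sum_two_pairs _ _ _ (fun x => x ^+ 2)) ?expr0n// !sqrrN aa bb; lra.
rewrite dominating_pair_form//.
under eq_bigr do rewrite mxE -expr2.
rewrite (@sum_pair_two_pairs _ _ _ (fun x => x ^+ 2)) sqrrN aa; congr (_ * _); lra.
Qed.

(** Both sides equal the real segment [0, n]: each lies in it, the hull contains its endpoints as
    eigenvalues, and the range contains all its points by [dominating_pair_rayleigh]. *)
Lemma dominating_pair_polygonal (R : realType) (m : nat) :
  polygonal R (dominating_pair m.+4).
Proof.
move=> Q rQ; set S := (X in convex_hull X); set n := m.+4.
(* The equations allow a nonzero a only for z = n and a nonzero b only for z = 0. *)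
have eS (a b : R[i]) z : (a != 0) || (b != 0) ->
    n%:R * a = z * a -> 0 = z * b -> S z.
  move=> ab az bz; apply/(eigenvalue_compressionP _ _ rQ).
  exists (two_pairs a b)^T; split.
  - apply: contraTneq ab => /rowP w0.
    have := w0 0; have := w0 (inord 2); rewrite !mxE inordK//= => -> ->.
    by rewrite eqxx.
  - apply/matrixP => i j; rewrite !ord1 mxE.
    under eq_bigr do rewrite mxE [ones _ _ _ _]mxE mulr1.
    by rewrite (@sum_two_pairs _ _ _ id)// !subrr addr0 mxE.
  - apply: dominating_pair_eigenvector => [|i].
      under eq_bigr do rewrite mxE.
      by rewrite (@sum_pair_two_pairs _ _ _ id) subrr.
    rewrite !mxE; case: i => -[|[|[|[|i]]]] ? /=; rewrite ?mulr1 ?mulr0 ?mul0r//.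
    + by rewrite !mulrN az.
    + by rewrite mulrN -bz oppr0.
    + by rewrite nth_nil mulr0.
have S0 : S 0 by apply: (eS 0 1); rewrite ?oner_eq0 ?orbT ?mulr0 ?mul0r.
have Sn : S n%:R by apply: (eS 1 0); rewrite ?oner_eq0 ?mulr0 ?mul0r.
have interval (z : R[i]) : 0 <= z <= n%:R ->
    exists2 p : R, 0 <= p <= 1 & z = (n%:R * p)%:C%C.
  move=> /andP[z0 zn]; exists (complex.Re z / n%:R).
    move: z0 zn; rewrite !lecE => /andP[_ /= z0] /andP[_]; rewrite raddfMn/= => zn.
    by rewrite divr_ge0 ?ler0n//= ler_pdivrMr ?ltr0n// mul1r.
  rewrite mulrC divfK ?pnatr_eq0//; apply/esym/RRe_real.
  by rewrite realE z0.
apply/seteqP; split => z.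
  move=> /dominating_pair_range/interval[p /andP[p0 p1] ->].
  (* The point n p is the combination of n and 0 with weights p and 1 - p; [sel] is polymorphic
     because the weights are real and the points complex. *)
  pose sel (k : 'I_2) (T : Type) (x y : T) := if k == 0 then x else y.
  exists 2%N, (fun k => sel k _ p (1 - p)), (fun k => sel k _ n%:R 0).
  split.
  - by move=> k; rewrite /sel; case: ifP; rewrite ?subr_ge0.
  - by rewrite !big_ord_recl big_ord0 /sel/= addr0 addrC subrK.
  - by move=> k; rewrite /sel; case: ifP => _; [exact: Sn|exact: S0].
  - rewrite !big_ord_recl big_ord0 /sel/= mulr0 !addr0 rmorphM/= rmorph_nat.
    by rewrite mulrC.
move=> hz; have /interval[p pI ->] : 0 <= z <= n%:R.
  case: hz => k [t [v [t0 t1 Sv ->]]].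
  have vb l : 0 <= v l <= n%:R.
    have [w [w0 we wL]] := (eigenvalue_compressionP _ _ rQ).1 (Sv l).
    exact: dominating_pair_eigenvalue_bounds w0 we wL.
  have tC l : 0 <= (t l)%:C%C by rewrite ler0c.
  rewrite sumr_ge0/=; last by move=> l _; rewrite mulr_ge0//; case/andP: (vb l).
  have -> : n%:R = \sum_l (t l)%:C%C * n%:R :> R[i].
    by rewrite -mulr_suml -rmorph_sum/= t1 rmorph1 mul1r.
  by apply: ler_sum => l _; apply: ler_wpM2l => //; case/andP: (vb l).
exact/rayleigh_restricted_range/dominating_pair_rayleigh.
Qed.

Unset Implicit Arguments.

Theorem theorem3p4 (R : realType) :
  (forall n : nat, (2 <= n)%N ->
     forall G : digraph n, polygonal R G -> spread R G <= n%:R) /\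
  (forall n : nat, (4 <= n)%N ->
     exists G : digraph n, polygonal R G /\ spread R G = n%:R).
Proof.
split=> [n n2 G pG|n n4].
  have [Q rQ] := restrictor_exists R (ltnW n2).
  have bnd r : rayleigh R G r -> 0 <= r <= n%:R.
    move=> /rayleigh_restricted_range; rewrite (pG Q rQ).
    apply: convex_hull_Re_bounds => z /(eigenvalue_compressionP _ _ rQ).
    by move=> [w [w0 we wL]]; exact: laplacian_eigenvalue_bounds w0 we wL.
  have /andP[a0 _] := bnd _ (alpha_min R n G n2).1.
  have /andP[_ bn] := bnd _ (beta_max R n G n2).1.
  by rewrite /spread lerBlDr (le_trans bn)// lerDl.
case: n n4 => [|[|[|[|m]]]] // _; exists (dominating_pair m.+4).
split; first exact: dominating_pair_polygonal.
have bnd r : rayleigh R (dominating_pair m.+4) r -> 0 <= r <= m.+4%:R.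
  move=> /rayleigh_restricted_range/dominating_pair_range.
  by rewrite -(rmorph_nat (real_complex R)) ler0c lecR.
have [ra amin] := alpha_min R _ (dominating_pair m.+4) (isT : (2 <= m.+4)%N).
have [rb bmax] := beta_max R _ (dominating_pair m.+4) (isT : (2 <= m.+4)%N).
(* The endpoints p = 0 and p = 1 attain the values 0 and n, which [bnd] shows to be extremal. *)
have r0 := @dominating_pair_rayleigh R m 0; rewrite mulr0 lexx ler01 in r0.
have rn := @dominating_pair_rayleigh R m 1; rewrite mulr1 lexx ler01 in rn.
rewrite /spread; have -> : beta R (dominating_pair m.+4) = m.+4%:R.
  by apply/le_anti; rewrite (bmax _ (rn isT)) andbT; case/andP: (bnd _ rb).
have -> : alpha R (dominating_pair m.+4) = 0.
  by apply/le_anti; rewrite (amin _ (r0 isT)); case/andP: (bnd _ ra).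
exact: subr0.
Qed.
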